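(* Let $n>0$ be an odd integer and let $G$ be a group such that its non-cyclic graph is isomorphic to the non-cyclic graph of $H=Q_8\times\mathbb{Z}_n$. Then $G\cong Q_8\times\mathbb{Z}_n$.
   Context: A group is locally cyclic if each of its finitely generated subgroups is cyclic. For a group $G$, $Cyc(G)=\{x\in G : \langle x,y\rangle \text{ is cyclic for all } y\in G\}$. For a non locally cyclic group $G$, the non-cyclic graph $\Gamma_G$ is the simple graph with vertex set $G\setminus Cyc(G)$ in which two distinct vertices $x,y$ are adjacent if and only if $\langle x,y\rangle$ is not cyclic; speaking of the non-cyclic graph of $G$ presupposes that $G$ is not locally cyclic ($G$ is not assumed finite). $Q_8$ is the quaternion group of order $8$ and $\mathbb{Z}_n$ is the cyclic group of order $n$. *)

(* Defs.v *)
From HB Require Import structures.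
From mathcomp Require Import all_boot all_fingroup zmodp all_solvable.
From mathcomp Require Import classical_sets cardinality.

Set Implicit Arguments.
Unset Strict Implicit.
Unset Printing Implicit Defensive.

Local Open Scope classical_set_scope.
Local Open Scope group_scope.

(* [groupType] allows infinite groups, whereas the subgroup theory of fingroup
   is restricted to finite ones; hence the definitions below. *)
Section Groups.
Variable G : groupType.
Implicit Types (A X : set G) (x y : G).

Definition is_subgroup A : Prop :=
  [/\ A 1, forall x y, A x -> A y -> A (x * y) & forall x, A x -> A x^-1].

Definition gen X : set G := smallest is_subgroup X.

Definition is_cyclic A : Prop := exists g, A = gen [set g].

Definition finitely_generated A : Prop :=
  exists2 X, finite_set X & A = gen X.

Definition locally_cyclic : Prop :=
  forall A, finitely_generated A -> is_cyclic A.

Definition Cyc : set G := [set x | forall y, is_cyclic (gen [set x; y])].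

End Groups.

Arguments locally_cyclic : clear implicits.
Arguments Cyc : clear implicits.

Definition group_isomorphic (G H : groupType) : Prop :=
  exists f : {multiplicative G -> H}, bijective f.

Record simple_graph := SimpleGraph {
  vertex :> Type;
  adj : vertex -> vertex -> Prop;
  adj_sym : forall u v, adj u v -> adj v u;
  adj_irrefl : forall u, ~ adj u u
}.

Definition graph_isomorphic (g h : simple_graph) : Prop :=
  exists2 f : g -> h, bijective f & forall u v, adj u v <-> adj (f u) (f v).

Section NonCyclicGraph.
Variable G : groupType.

Let V : Type := set_type (~` Cyc G).

Definition non_cyclic_adj (u v : V) : Prop :=
  u <> v /\ ~ is_cyclic (gen [set val u; val v]).

Lemma non_cyclic_adj_sym u v : non_cyclic_adj u v -> non_cyclic_adj v u.
Proof. by move=> [uv ncyc]; split=> [/esym //|]; rewrite setUC. Qed.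

Lemma non_cyclic_adj_irrefl u : ~ non_cyclic_adj u u.
Proof. by case. Qed.

(* Defined for every [G], but only meaningful when [G] is not locally cyclic:
   otherwise the vertex set is empty. *)
Definition non_cyclic_graph : simple_graph :=
  SimpleGraph non_cyclic_adj_sym non_cyclic_adj_irrefl.

End NonCyclicGraph.

(* Unlike ['Z_n], which is Z/2Z for n = 1, the additive group ['I_n.-1.+1] has
   order n for every n > 0. *)
Definition Q8xZ (n : nat) : groupType := ('Q_8 * 'I_n.-1.+1)%type.

(* Main.v *)
From HB Require Import structures.
Require Import Defs.
From mathcomp Require Import boolp classical_sets cardinality.
From mathcomp Require Import all_boot all_fingroup zmodp all_solvable.
From mathcomp Require Import zify.

(* The non-cyclic graph of Q_8 x Z_n is complete tripartite with parts of size
   k = 2n: (q, i) and (w, j) are adjacent iff q and w generate Q_8. Suppose G has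
   such a graph. Its vertex set is finite and a translate of Cyc(G) embeds into it,
   so G is finite. For a vertex x, transitivity of non-adjacency makes the part of x
   together with Cyc(G) a cyclic subgroup, of order |Cyc(G)| + k. This divides
   |G| = |Cyc(G)| + 3k, which forces |Cyc(G)| = k = 2n, so |G| = 8n. Now Cyc(G) is
   central and cyclic, its subgroup of order n is a direct complement of a Sylow
   2-subgroup S, and every element of S outside Cyc(G) squares to the unique
   involution of S, so S is quaternion of order 8. *)

Set Implicit Arguments.
Unset Strict Implicit.
Unset Printing Implicit Defensive.

Import GroupScope.

(** * Cyclic subgroups and [Cyc] in arbitrary groups *)

Section ArbitraryGroups.
Local Open Scope classical_set_scope.

Section CyclicSubgroups.
Variable G : groupType.
Implicit Types (A B X : set G) (x y z c : G).

Lemma gen_is_subgroup X : is_subgroup (gen X).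
Proof.
split=> [A [[A1 _ _] _] //|x y Xx Xy A sgA|x Xx A sgA].
  by case: (sgA) => -[_ AM _] _; apply: AM; [apply: Xx | apply: Xy].
by case: (sgA) => -[_ _ AV] _; apply: AV; apply: Xx.
Qed.

Lemma sub_gen X : X `<=` gen X.
Proof. exact: sub_gen_smallest. Qed.

Lemma gen_sub A X : is_subgroup A -> X `<=` A -> gen X `<=` A.
Proof. exact: smallest_sub. Qed.

Lemma is_subgroupX A x i : is_subgroup A -> A x -> A (x ^+ i).
Proof.
by move=> [A1 AM AV] Ax; elim: i => [//|i IHi]; rewrite expgS; apply: AM.
Qed.

Lemma is_subgroupVl A x : is_subgroup A -> A x^-1 -> A x.
Proof. by move=> [_ _ AV] /AV; rewrite invgK. Qed.

Lemma gen1_powers c x :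
  gen [set c] x -> exists i, x = c ^+ i \/ x = c ^- i.
Proof.
suff sgP : is_subgroup [set y | exists i, y = c ^+ i \/ y = c ^- i].
  by apply: (gen_sub sgP) => _ ->; exists 1%N; left; rewrite expg1.
(* Exponents are natural numbers, so a product of a power and an inverse power is simplified
   according to which exponent is larger. *)
have expBE i j : j <= i -> c ^+ i * c ^- j = c ^+ (i - j).
  by move=> ji; rewrite -{1}(subnK ji) expgnDr mulgK.
have expBE' i j : j <= i -> c ^- j * c ^+ i = c ^+ (i - j).
  by move=> ji; rewrite -{1}(subnKC ji) expgnDr mulKg.
have expVB i j : i <= j -> c ^+ i * c ^- j = c ^- (j - i).
  by move=> ij; rewrite -[LHS]invgK invMg invgK expBE.
have expVB' i j : i <= j -> c ^- j * c ^+ i = c ^- (j - i).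
  by move=> ij; rewrite -[LHS]invgK invMg invgK expBE'.
split.
- by exists 0%N; left; rewrite expg0.
- move=> _ _ [i [] ->] [j [] ->].
  + by exists (i + j)%N; left; rewrite expgnDr.
  + case: (leqP j i) => ij; first by exists (i - j)%N; left; apply: expBE.
    by exists (j - i)%N; right; apply: expVB; apply: ltnW.
  + case: (leqP i j) => ij; first by exists (j - i)%N; left; apply: expBE'.
    by exists (i - j)%N; right; apply: expVB'; apply: ltnW.
  + by exists (j + i)%N; right; rewrite -invMg -expgnDr.
- move=> _ [i [] ->]; exists i; first by right.
  by left; rewrite invgK.
Qed.

(** The least positive exponent whose power of [c] lies in [A] divides, by Euclidean division, every
    exponent [i] with [c ^+ i] in [A]. The order of [c] may be infinite. *)
Lemma is_cyclicS A B : is_subgroup A -> A `<=` B -> is_cyclic B -> is_cyclic A.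
Proof.
move=> sgA sAB [c defB].
have [A1 AM AV] := sgA.
have powA x : A x -> exists2 i, A (c ^+ i) & x = c ^+ i \/ x = c ^- i.
  move=> Ax; have := sAB _ Ax; rewrite defB => /gen1_powers[i defx].
  exists i => //; case: defx => defx; rewrite -?defx //.
  by apply: is_subgroupVl sgA _; rewrite -defx.
(* Writing exponents as [i.+1] keeps them positive; if no such power lies in [A], then [A] is
   trivial. *)
have [[d Ad]|noA] := pselect (exists i, A (c ^+ i.+1)); last first.
  exists 1; apply/seteqP; split=> [x /powA[[|i] Ai]|].
  - by rewrite expg0 invg1; case=> ->; case: (gen_is_subgroup [set 1]).
  - by case: noA; exists i.
  by apply: gen_sub => // _ ->.
have exd : exists i, `[< A (c ^+ i.+1) >] by exists d; apply/asboolP.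
case: (ex_minnP exd) => {Ad exd}d /asboolP Ad mind.
exists (c ^+ d.+1); apply/seteqP; split=> [x /powA[i Ai defx]|]; last first.
  by apply: gen_sub => // _ ->.
suff gi : gen [set c ^+ d.+1] (c ^+ i).
  by case: defx => ->//; case: (gen_is_subgroup [set c ^+ d.+1]) => _ _; apply.
have gq : gen [set c ^+ d.+1] (c ^+ (d.+1 * (i %/ d.+1))).
  rewrite expgM; apply: (is_subgroupX _ (gen_is_subgroup _)).
  exact: sub_gen.
have Ar : A (c ^+ (i %% d.+1)).
  have -> : c ^+ (i %% d.+1) = (c ^+ d.+1 ^+ (i %/ d.+1))^-1 * c ^+ i.
    have := expgnDr c (i %/ d.+1 * d.+1) (i %% d.+1).
    by rewrite -divn_eq mulnC -expgM => ->; rewrite mulKg.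
  by apply: AM => //; apply: AV; apply: is_subgroupX.
rewrite (divn_eq i d.+1) mulnC; case defr: (i %% d.+1) Ar => [|r] Ar.
  by rewrite addn0.
have /mind : `[< A (c ^+ r.+1) >] by apply/asboolP.
by rewrite leqNgt -ltnS -defr ltn_mod.
Qed.

Lemma is_cyclic_gen2P x y :
  is_cyclic (gen [set x; y]) <->
  exists c, gen [set c] x /\ gen [set c] y.
Proof.
split=> [[c defc]|[c [cx cy]]].
  by exists c; rewrite -defc; split; apply: sub_gen; [left | right].
apply: (@is_cyclicS _ (gen [set c])); first exact: gen_is_subgroup.
  by apply: gen_sub (gen_is_subgroup _) _ => _ [] ->.
by exists c.
Qed.

Lemma Cyc_is_subgroup : is_subgroup (Cyc G).
Proof.
split=> [y|x z Cx Cz y|x Cx y].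
- apply/is_cyclic_gen2P; exists y; split; last exact: sub_gen.
  by case: (gen_is_subgroup [set y]).
- have /is_cyclic_gen2P[c [cx cy]] := Cx y.
  (* The hypothesis on [z] is applied to [c] rather than [y]: [gen [set d]] then contains [z] and
     all of [gen [set c]], hence [x] and [y]. *)
  have /is_cyclic_gen2P[d [dz dc]] := Cz c.
  have scd : gen [set c] `<=` gen [set d].
    by apply: gen_sub (gen_is_subgroup _) _ => _ ->.
  apply/is_cyclic_gen2P; exists d; split; last exact: scd.
  by case: (gen_is_subgroup [set d]) => _ dM _; apply: dM => //; apply: scd.
- have /is_cyclic_gen2P[c [cx cy]] := Cx y.
  apply/is_cyclic_gen2P; exists c; split=> //.
  by case: (gen_is_subgroup [set c]) => _ _; apply.
Qed.

(* Left translation by [x] injects [Cyc G] into its complement. *)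
Lemma finite_group_of_finite_setC_Cyc x :
  ~ Cyc G x -> finite_set (~` Cyc G) -> finite_set [set: G].
Proof.
move=> nCx finV; rewrite -(setUv (Cyc G)) finite_setU; split=> //.
have [_ CM CV] := Cyc_is_subgroup.
apply: (@sub_finite_set _ _ ((mulg x^-1) @` (~` Cyc G))).
  move=> z Cz; exists (x * z); last by rewrite mulKg.
  by move=> /CM/(_ (CV _ Cz)); rewrite mulgK.
exact: finite_image.
Qed.

End CyclicSubgroups.

(** * Finite group structures and maps induced by graph isomorphisms *)

(** An equality of group structures, rather than an isomorphism, lets the graph hypothesis be
    transported by rewriting. *)
Lemma finite_group_finGroup (G : groupType) :
  finite_set [set: G] -> exists gT : finGroupType, (gT : groupType) = G.
Proof.
case/finite_seqP=> s defG.
have s_enum x : x \in s.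
  by have : [set: G] x by []; rewrite defG.
have {defG} enumP : Finite.axiom (undup s).
  by move=> x; rewrite count_uniq_mem ?undup_uniq // mem_undup s_enum.
have nthK : pcancel (index^~ s) (nth None (map some s)).
  by move=> x; rewrite (nth_map x) ?index_mem // nth_index.
have cT := PCanIsCountable nthK.
have fT := isFinite.Build _ enumP.
pose gT : finGroupType := HB.pack G cT fT.
(* Destructing [G] makes the repackaged group structure convertible to it. *)
exists gT; rewrite {}/gT; move: cT fT => {s s_enum enumP nthK}.
by case: G => T cG cT fT; reflexivity.
Qed.

(* The vertex sets are subtypes, so the isomorphism is extended to the whole
   groups by the junk value 1 on [Cyc]. *)
Lemma graph_isomorphic_maps (G H : groupType) :
  graph_isomorphic (non_cyclic_graph G) (non_cyclic_graph H) ->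
  exists (F : G -> H) (F' : H -> G),
    [/\ forall x, ~ Cyc G x -> ~ Cyc H (F x) /\ F' (F x) = x,
        forall y, ~ Cyc H y -> ~ Cyc G (F' y) /\ F (F' y) = y
      & forall x y, ~ Cyc G x -> ~ Cyc G y ->
        is_cyclic (gen [set x; y]) <-> is_cyclic (gen [set F x; F y])].
Proof.
have gen_xx (K : groupType) (x : K) : is_cyclic (gen [set x; x]).
  by exists x; rewrite classical_sets.setUid.
have mem_V (K : groupType) x : ~ Cyc K x -> x \in ~` Cyc K by move/mem_set.
move=> [f [g fK gK] adjf].
pose ext (K L : groupType) (h : non_cyclic_graph K -> non_cyclic_graph L) x :=
  if insub x is Some u then val (h u) else 1.
have extE K L h x (Kx : x \in ~` Cyc K) : @ext K L h x = val (h (SigSub Kx)).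
  by rewrite /ext insubT.
exists (ext _ _ f), (ext _ _ g); split.
- move=> x /mem_V Gx; rewrite (extE _ _ f _ Gx) /ext valK fK; split=> //.
  by have /set_mem := valP (f (SigSub Gx)).
- move=> y /mem_V Hy; rewrite (extE _ _ g _ Hy) /ext valK gK; split=> //.
  by have /set_mem := valP (g (SigSub Hy)).
move=> x y /mem_V Gx /mem_V Gy.
rewrite (extE _ _ f _ Gx) (extE _ _ f _ Gy).
(* Adjacency says nothing about equal vertices; for them both subgroups are cyclic. *)
have [eq_xy|ne_xy] := pselect (SigSub Gx = SigSub Gy :> classical_sets.set_type (~` Cyc G)).
  by have [yx] := esym eq_xy; rewrite -eq_xy yx; split=> _; apply: gen_xx.
have ne_fxy : f (SigSub Gx) <> f (SigSub Gy) by move=> /(can_inj fK).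
have := adjf (SigSub Gx) (SigSub Gy); rewrite /= /non_cyclic_adj /=.
by move=> [GH HG]; split=> cyc; apply: contrapT => ncyc; [case: HG | case: GH].
Qed.

End ArbitraryGroups.

(** * Boolean counterparts for finite groups *)

Section FiniteGroups.
Variable gT : finGroupType.
Implicit Types (x y z c : gT).

Definition cyclic2 x y := cyclic <<[set x; y]>>.
Definition center_cyclic2 := [set x | [forall y, cyclic2 x y]].

Lemma cyclic2P x y :
  reflect (exists c, x \in <[c]> /\ y \in <[c]>) (cyclic2 x y).
Proof.
rewrite /cyclic2; apply: (iffP cyclicP) => [[c defc]|[c [cx cy]]].
  by exists c; rewrite -defc !mem_gen // !inE eqxx ?orbT.
apply/cyclicP; apply: cyclicS (cycle_cyclic c).
by rewrite gen_subG subUset !sub1set cx cy.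
Qed.

Lemma cyclic2C x y : cyclic2 x y = cyclic2 y x.
Proof. by rewrite /cyclic2 setUC. Qed.

Lemma cyclic2xx x : cyclic2 x x.
Proof. by apply/cyclic2P; exists x; rewrite cycle_id. Qed.

Lemma gen_generated (X : classical_sets.set gT) (A : {set gT}) :
  (forall x, X x <-> x \in A) -> forall x, gen X x <-> x \in <<A>>.
Proof.
move=> XA x; split.
  apply: (@gen_sub _ [set` <<A>>]%classic) => [|y /XA Ay]; last first.
    exact: mem_gen.
  by split=> [|y z|y]; [exact: group1 | exact: groupM | rewrite /= groupV].
move=> Ax B [sgB sXB]; have [B1 BM BV] := sgB.
(* Minimality of [<<A>>] needs a finite-group version of [B]; [group_set] asks only for 1 and
   products. *)
have gB : group_set [set y | `[< B y >]].
  apply/group_setP; split=> [|y z]; rewrite !inE; first exact/asboolP.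
  by move=> /asboolP By /asboolP Bz; apply/asboolP; apply: BM.
suff /subsetP/(_ x Ax) : <<A>> \subset Group gB by rewrite inE => /asboolP.
rewrite gen_subG; apply/subsetP=> y Ay; rewrite inE; apply/asboolP.
by apply: sXB; apply/XA.
Qed.

Lemma is_cyclic_cyclic2 x y :
  is_cyclic (gen [set x; y]%classic) <-> cyclic2 x y.
Proof.
have gen1 (c z : gT) : gen [set c]%classic z <-> z \in <[c]>.
  by apply: gen_generated => t; rewrite inE; split=> [->|/eqP].
split=> [/is_cyclic_gen2P[c [/gen1 cx /gen1 cy]]|/cyclic2P[c [cx cy]]].
  by apply/cyclic2P; exists c.
by apply/is_cyclic_gen2P; exists c; split; apply/gen1.
Qed.

Lemma CycE x : Cyc gT x <-> x \in center_cyclic2.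
Proof.
rewrite inE; split=> [Cx|/forallP Cx y]; last exact/is_cyclic_cyclic2.
by apply/forallP=> y; apply/is_cyclic_cyclic2/Cx.
Qed.

Lemma center_cyclic2_group_set : group_set center_cyclic2.
Proof.
have [C1 CM _] := Cyc_is_subgroup gT.
apply/group_setP; split=> [|x y /CycE Cx /CycE Cy]; first exact/CycE.
by apply/CycE/CM.
Qed.
Canonical center_cyclic2_group := Group center_cyclic2_group_set.

(** For [0 < k], this describes the complete tripartite graph with parts of size [k]: [cyclic2] is
    an equivalence relation on the vertices, and its classes are counted instead of named. *)
Definition three_classes_graph (k : nat) :=
  [/\ {in ~: center_cyclic2 & &, forall x y z,
         cyclic2 x y -> cyclic2 y z -> cyclic2 x z},
      #|~: center_cyclic2| = (3 * k)%N
    & {in ~: center_cyclic2, forall x,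
         #|[set y in ~: center_cyclic2 | cyclic2 x y]| = k}].

End FiniteGroups.

(** * Structure of finite groups with such a graph *)

Arguments center_cyclic2 : clear implicits.

(* The classes, completed by [center_cyclic2], are the maximal cyclic subgroups. *)
Lemma maximal_cyclicP (gT : finGroupType) k (x : gT) :
    three_classes_graph gT k -> x \notin center_cyclic2 gT ->
  exists c, <[c]> = [set y | cyclic2 x y].
Proof.
move=> [tr _ _] Vx; set Z := center_cyclic2 gT in tr Vx *.
(* A vertex of maximal order in the class of [x] will generate. If [d] generates a cyclic group
   containing [c] and [y], then [d] is again a vertex of this class, so [<[c]> = <[d]>]. *)
pose P := [pred c | (c \notin Z) && cyclic2 x c].
have Px : P x by rewrite /= Vx cyclic2xx.
case: (arg_maxnP (fun c => #[c]) Px) => c /andP[/= Vc xc] maxc.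
have class_sub y : cyclic2 x y -> y \in <[c]>.
  move=> xy; have /cyclic2P[d [dc dy]] : cyclic2 c y.
    have [|Vy] := boolP (y \in Z); last first.
      by apply: (tr _ x); rewrite ?in_setC // cyclic2C.
    by rewrite inE => /forallP; rewrite cyclic2C.
  have Vd : d \notin Z.
    apply: contra Vc; rewrite -!cycle_subG; apply: subset_trans.
    by rewrite cycle_subG.
  have cd : cyclic2 c d by apply/cyclic2P; exists d; rewrite cycle_id.
  have /maxc le_dc : P d by rewrite /= Vd (tr _ c) ?in_setC.
  suff -> : <[c]> = <[d]> by [].
  by apply/eqP; rewrite eqEcard cycle_subG dc.
exists c; apply/setP=> y; rewrite inE; apply/idP/idP=> [cy|/class_sub//].
by apply/cyclic2P; exists c; split=> //; apply/class_sub/cyclic2xx.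
Qed.

Lemma center_cyclic2_cent (gT : finGroupType) :
  center_cyclic2 gT \subset 'C([set: gT]).
Proof.
apply/subsetP=> z; rewrite inE => /forallP Cz; apply/centP=> y _.
have /cyclic2P[c [cz cy]] := Cz y.
by apply: (centsP (cycle_abelian c)).
Qed.

Lemma three_classes_card (gT : finGroupType) k :
    0 < k -> three_classes_graph gT k ->
  [/\ #|gT| = (4 * k)%N, #|center_cyclic2 gT| = k
    & forall x, x \notin center_cyclic2 gT ->
        exists c, [/\ <[c]> = [set y | cyclic2 x y], #[c] = k.*2,
                      x \in <[c]> & center_cyclic2 gT \subset <[c]> ]].
Proof.
move=> k_gt0 Gk; have [_ cardV classV] := Gk.
have class_cyc x (Vx : x \notin center_cyclic2 gT) :
    exists c, [/\ <[c]> = [set y | cyclic2 x y],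
      #[c] = (#|center_cyclic2 gT| + k)%N,
      x \in <[c]> & center_cyclic2 gT \subset <[c]> ].
  have [c defc] := maximal_cyclicP Gk Vx; exists c.
  have sZc : center_cyclic2 gT \subset <[c]>.
    apply/subsetP=> z; rewrite defc !inE => /forallP; rewrite cyclic2C; apply.
  split=> //; last by rewrite defc inE cyclic2xx.
  rewrite orderE -(cardsID (center_cyclic2 gT) <[c]>); congr (_ + _)%N.
    by rewrite (setIidPr sZc).
  rewrite -(classV x) ?in_setC //; apply: eq_card => y.
  by rewrite defc !inE.
have [x Vx] : exists x, x \notin center_cyclic2 gT.
  have /card_gt0P[x Vx] : 0 < #|~: center_cyclic2 gT| by rewrite cardV; lia.
  by exists x; rewrite in_setC in Vx.
have oG : #|gT| = (#|center_cyclic2 gT| + 3 * k)%N by rewrite -cardV cardsC.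
have [c [_ oc _ _]] := class_cyc x Vx.
have := order_dvdG (in_setT c); rewrite cardsT oG oc.
have : 0 < #|center_cyclic2 gT| by apply: cardG_gt0.
move: oG class_cyc; set m := #|center_cyclic2 gT| => oG class_cyc m_gt0 /dvdnP[t def_t].
(* Here [m + 3k = t(m + k)]: [t <= 1] contradicts [k > 0], [t >= 3] contradicts [m > 0], and [t = 2]
   gives [m = k]. *)
have mk : m = k.
  by clear -def_t m_gt0 k_gt0; case: t def_t => [|[|[|t]]]; nia.
rewrite mk; split=> //.
by move=> y /class_cyc[d [? od ? ?]]; exists d; split=> //; rewrite od mk addnn.
Qed.

Lemma three_classes_Q8xZ (gT : finGroupType) n :
    0 < n -> odd n -> three_classes_graph gT n.*2 ->
  [set: gT] \isog [set: 'Q_8 * 'I_n.-1.+1].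
Proof.
move=> n_gt0 n_odd Gn.
have n2_gt0 : 0 < n.*2 by rewrite double_gt0.
have [oG oZ cycV] := three_classes_card n2_gt0 Gn.
have co2n k : coprime (2 ^ k) n by rewrite coprimeXl // coprime2n.
pose Z := center_cyclic2_group gT.
rewrite -[center_cyclic2 gT]/(gval Z) in oZ cycV.
have cycZ : cyclic Z.
  have [x Vx] : exists x, x \notin Z.
    case: Gn => _ cardV _.
    have /card_gt0P[x Vx] : 0 < #|~: Z| by rewrite cardV; lia.
    by exists x; rewrite in_setC in Vx.
  by have [c [_ _ _ sZc]] := cycV x Vx; apply: cyclicS sZc (cycle_cyclic c).
have [S sylS] := Sylow_exists 2 [set: gT].
have oS : #|S| = 8.
  have def8n : (4 * n.*2 = 2 ^ 3 * n)%N by lia.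
  rewrite (card_Hall sylS) cardsT oG def8n partnM // part_pnat_id ?pnatX //.
  by rewrite part_p'nat ?muln1 // -odd_2'nat.
(* The order of [s] divides 8, and also [4n]: it divides [2n] if [s] is in [Z], and the order of a
   maximal cyclic subgroup otherwise. *)
have ord4 s : s \in S -> #[s] %| 4.
  move=> Ss; have s8 : #[s] %| 2 ^ 3 by rewrite -[(2 ^ 3)%N]oS order_dvdG.
  have s4n : #[s] %| 4 * n.
    have [Zs|Vs] := boolP (s \in Z).
      have -> : (4 * n = 2 * n.*2)%N by lia.
      by rewrite dvdn_mull // -oZ order_dvdG.
    have [c [_ oc cs _]] := cycV s Vs.
    have -> : (4 * n = n.*2.*2)%N by lia.
    by rewrite -oc order_dvdG.
  by rewrite Gauss_dvdl in s4n => //; apply: coprime_dvdl s8 (co2n 3).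
(* Inside the cyclic group [<[c]>], inclusion of subgroups is divisibility of orders, and 2 divides
   the order [2n] of [Z]. *)
have sqr1_Z s : s ^+ 2 = 1 -> s \in Z.
  move=> s2; apply: contraT => Vs; suff : s \in Z by rewrite (negPf Vs).
  have [c [_ oc cs sZc]] := cycV s Vs.
  rewrite -cycle_subG -(cardSg_cyclic (cycle_cyclic c)) ?cycle_subG //=.
  by rewrite oZ -mul2n dvdn_mulr // -orderE order_dvdn s2.
have Z_sqr1 s : s \in S -> s \in Z -> s ^+ 2 = 1.
  move=> Ss Zs; apply/eqP; rewrite -order_dvdn.
  have : #[s] %| 2 * n by rewrite mul2n -oZ order_dvdG.
  by rewrite Gauss_dvdl //; apply: coprime_dvdl (ord4 s Ss) (co2n 2).
have [w defW] : exists w, S :&: Z = <[w]>.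
  by apply/cyclicP; apply: cyclicS cycZ; apply: subsetIr.
have /setIP[Sw Zw] : w \in S :&: Z by rewrite defW cycle_id.
have le_w2 : #[w] <= 2 by rewrite dvdn_leq // order_dvdn Z_sqr1.
(* [s ^+ 2] lies in [<[w]>], which has at most two elements, and is not 1 because elements of square
   1 lie in [Z]. *)
have sqr_w s : s \in S -> s \notin Z -> s ^+ 2 = w.
  move=> Ss Vs; have : s ^+ 2 \in <[w]>.
    rewrite -defW inE groupX //= sqr1_Z // -expgM; apply/eqP.
    by rewrite -order_dvdn ord4.
  case/cyclePmin=> [[|[|i]]] lt_i_w s2; last by move: (leq_trans lt_i_w le_w2).
    by rewrite sqr1_Z in Vs.
  by rewrite s2 expg1.
have [a Sa Va] : exists2 a, a \in S & a \notin Z.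
  suff : ~~ (S \subset Z) by case/subsetPn => a; exists a.
  apply/negP=> /setIidPl sSZ; move: le_w2.
  by rewrite orderE -defW sSZ oS.
have aw := sqr_w a Sa Va.
have oa : #[a] = 4.
  have : ~~ (#[a] %| 2) by apply: contra Va; rewrite order_dvdn => /eqP/sqr1_Z.
  by move: (ord4 a Sa); case: #[a] => [|[|[|[|[|i]]]]] // /dvdn_leq; apply.
have Z_a s : s \in S -> s \in Z -> s \in <[a]>.
  move=> Ss Zs; have : s \in <[w]> by rewrite -defW inE Ss.
  by apply/subsetP; rewrite cycle_subG -aw groupX ?cycle_id.
have [b Sb nab] : exists2 b, b \in S & b \notin <[a]>.
  suff : ~~ (S \subset <[a]>) by case/subsetPn => b; exists b.
  by apply/negP=> /subset_leq_card; rewrite oS -orderE oa.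
have Vb : b \notin Z by apply: contra nab; apply: Z_a.
have bw := sqr_w b Sb Vb.
(* If [a * b] were in [Z], it would lie in [<[a]>], and so would [b]. *)
have abw : (a * b) ^+ 2 = w.
  apply: sqr_w; first exact: groupM.
  apply: contra nab => Zab.
  by have := Z_a _ (groupM Sa Sb) Zab; rewrite groupMl ?cycle_id.
(* By the presentation of ['Q_8], the relations between [a] and [b] make [S] an image of ['Q_8]; the
   orders agree. *)
have isoS : S \isog 'Q_8.
  rewrite isogEcard (@card_quaternion 3) // oS leqnn andbT.
  rewrite (@Grp_quaternion 3) //; apply/existsP; exists (a, b).
  rewrite /= !xpair_eqE /=; apply/and4P; split.
  - rewrite eqEcard join_subG !cycle_subG Sa Sb /= oS.
    have oJ : #|<[a]> <*> <[b]>| %| 8.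
      by rewrite -oS cardSg // join_subG !cycle_subG Sa Sb.
    have : <[a]> \proper <[a]> <*> <[b]>.
      rewrite properE joing_subl /=; apply: contra nab => /subsetP; apply.
      by rewrite -cycle_subG joing_subr.
    by move=> /proper_card; rewrite -orderE oa; case: #|_| oJ => [|[|[|[|[|[|[|[|]]]]]]]].
  - by rewrite -order_dvdn ord4.
  - by rewrite bw aw.
  (* From [(a * b) ^+ 2 = a ^+ 2] follows [bab = a], hence [a ^ b = b ^- 2 * (bab) = a ^- 2 * a =
     a^-1]. *)
  - have bab : b * (a * b) = a.
      by apply: (mulgI a); move: abw; rewrite -aw !expg2 !mulgA.
    rewrite conjgE -(mulKg b (a * b)) bab mulgA -invMg -expg2 bw -aw expg2.
    by rewrite invMg mulgKV.
have [z defZ] := cyclicP cycZ.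
have oz : #[z] = n.*2 by rewrite orderE -defZ.
(* Since [Z] has order [2n], the square of its generator generates the subgroup of odd order [n],
   which is central and meets [S] trivially. *)
have oN : #[z ^+ 2] = n by rewrite orderXdiv oz -muln2 ?dvdn_mull ?mulnK.
have cSN : <[z ^+ 2]> \subset 'C(S).
  rewrite cycle_subG groupX // -cycle_subG -defZ.
  by apply: subset_trans (center_cyclic2_cent gT) (centS (subsetT S)).
have tiSN : S :&: <[z ^+ 2]> = 1.
  by apply: coprime_TIg; rewrite oS -orderE oN (co2n 3).
have defG : S \x <[z ^+ 2]> = [set: gT].
  rewrite dprodE //; apply/eqP; rewrite eqEcard subsetT TI_cardMg //.
  by rewrite cardsT oG oS -orderE oN; lia.
have defH : setX [set: 'Q_8] 1 \x setX 1 [set: 'I_n.-1.+1] = [set: 'Q_8 * 'I_n.-1.+1].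
  by rewrite setX_dprod; apply/setP=> -[q i]; rewrite !inE.
apply: (isog_dprod defG defH).
  by apply: isog_trans isoS _; exact: isog_setX1.
suff isoN : <[z ^+ 2]> \isog [set: 'I_n.-1.+1].
  by apply: isog_trans isoN _; exact: isog_set1X.
rewrite isog_cyclic_card ?cycle_cyclic // -orderE oN cardsT card_ord prednK //.
by rewrite eqxx andbT; apply/cyclicP; exists Zp1; apply: Zp_cycle.
Qed.

(** * The non-cyclic graph of Q_8 x Z_n *)

(** The witness is the square of a generator [x] of order 4: elements outside [<[x]>] have order 4,
    and [x ^+ 2] is the only involution. *)
Lemma Q8_involution :
  exists u : 'Q_8, [/\ #[u] = 2, forall q : 'Q_8, #[q] %| 4
                     & forall q : 'Q_8, (q ^+ 2 == 1) = (q \in <[u]>) ].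
Proof.
have [[x y] genQ _] := @generators_quaternion _ 'Q_8 3 isT (isog_refl _).
have [_ _ ox _] := genQ.
have [[_ ord4 _] _ [_ _ invol _ _] _ _] :=
  quaternion_structure (isT : 2 < 3) genQ (isog_refl _).
have ou : #[x ^+ 2] = 2 by rewrite orderXdiv ox.
exists (x ^+ 2); split=> // q.
  have [xq|nxq] := boolP (q \in <[x]>).
    by have := order_dvdG xq; rewrite -orderE ox.
  by rewrite ord4 // !inE nxq.
rewrite cycle2g // !inE; apply/idP/idP=> [|/orP[/eqP-> | /eqP->]].
- rewrite -order_dvdn dvdn_divisors // => /= q2.
  move: q2; rewrite !inE order_eq1 => /orP[-> // | /eqP q2].
  by rewrite [q](invol q) ?inE // eqxx orbT.
- by rewrite expg1n.
- by rewrite -order_dvdn ou.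
Qed.

(** Orders in ['Q_8] divide 4, which is coprime to [n], so [(c, Zp1)] generates the whole product of
    [<[c]>] and Z_n, and second components never obstruct cyclicity. *)
Lemma cyclic2_Q8xZ n (q w : 'Q_8) (i j : 'I_n.-1.+1) :
  0 < n -> odd n ->
  cyclic2 ((q, i) : 'Q_8 * 'I_n.-1.+1) (w, j) = cyclic2 q w.
Proof.
move=> n_gt0 n_odd; have [_ [_ ord4 _]] := Q8_involution.
have pairX (c : 'Q_8) (k : 'I_n.-1.+1) m :
    ((c, k) : 'Q_8 * 'I_n.-1.+1) ^+ m = (c ^+ m, k ^+ m).
  by elim: m => [|m IHm] //; rewrite !expgS IHm.
apply/cyclic2P/cyclic2P=> [[[c k] []]|[c [cq cw]]].
  case/cycleP=> s; rewrite pairX => -[-> _].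
  case/cycleP=> t; rewrite pairX => -[-> _].
  by exists c; rewrite !mem_cycle.
have gen_pair r k : r \in <[c]> ->
    ((r, k) : 'Q_8 * 'I_n.-1.+1) \in <[((c, Zp1) : 'Q_8 * 'I_n.-1.+1)]>.
  case/cycleP=> s ->; have : k \in <[Zp1]> by rewrite -Zp_cycle inE.
  (* The exponent is congruent to [s] modulo 4 and to [t] modulo [n]. *)
  case/cycleP=> t ->; apply/cycleP; exists (chinese 4 n s t); rewrite pairX.
  have co4n : coprime 4 n by rewrite -[4]/(2 ^ 2)%N coprimeXl // coprime2n.
  have c4 : c ^+ 4 = 1 by apply/eqP; rewrite -order_dvdn ord4.
  have Zp1n : (Zp1 : 'I_n.-1.+1) ^+ n = 1.
    by apply/eqP; rewrite -order_dvdn order_Zp1 prednK.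
  congr (_, _); first by rewrite -(expg_mod s c4) -(chinese_modl co4n s t) expg_mod.
  by rewrite -(expg_mod t Zp1n) -(chinese_modr co4n s t) expg_mod.
by exists (c, Zp1); split; apply: gen_pair.
Qed.

(** Each [q] outside [<[u]>] generates a maximal cyclic subgroup of order 4 containing [u]. So there
    are [(8 - 2)n] vertices, in classes of size [(4 - 2)n]. *)
Lemma Q8xZ_three_classes n :
  0 < n -> odd n -> three_classes_graph ('Q_8 * 'I_n.-1.+1)%type n.*2.
Proof.
move=> n_gt0 n_odd; have [u [ou ord4 sqr1]] := Q8_involution.
have oQ : #|[set: 'Q_8]| = 8 by apply: (@card_quaternion 3).
have oq q : q \notin <[u]> -> #[q] = 4.
  rewrite -sqr1 -order_dvdn; move: (ord4 q).
  by case: #[q] => [|[|[|[|[|i]]]]] // /dvdn_leq; apply.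
have sqr_u q : q \notin <[u]> -> q ^+ 2 = u.
  move=> nuq; have : q ^+ 2 \in <[u]>.
    by rewrite -sqr1 -expgM -order_dvdn ord4.
  rewrite cycle2g // !inE => /orP[|/eqP //].
  by rewrite sqr1 (negPf nuq).
have sub_u q : q \notin <[u]> -> <[u]> \subset <[q]>.
  by move=> nuq; rewrite cycle_subG -(sqr_u q) // mem_cycle.
have cyclic2_q q w : q \notin <[u]> -> cyclic2 q w = (w \in <[q]>).
  move=> nuq; apply/cyclic2P/idP=> [[c [cq cw]]|qw]; last first.
    by exists q; rewrite cycle_id.
  suff -> : <[q]> = <[c]> by [].
  apply/eqP; rewrite eqEcard cycle_subG cq -!orderE (oq q) //.
  by rewrite dvdn_leq.
have mem_center (q : 'Q_8) (i : 'I_n.-1.+1) :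
    ((q, i) \in center_cyclic2 ('Q_8 * 'I_n.-1.+1)%type) = (q \in <[u]>).
  rewrite inE; apply/forallP/idP=> [cyc|uq [w j]].
    apply: contraT => nuq; suff : [set: 'Q_8] \subset <[q]>.
      by move/subset_leq_card; rewrite oQ -orderE oq.
    apply/subsetP=> w _; rewrite -cyclic2_q //.
    by have := cyc (w, i); rewrite cyclic2_Q8xZ.
  rewrite cyclic2_Q8xZ //; have [uw|nuw] := boolP (w \in <[u]>).
    by apply/cyclic2P; exists u.
  by rewrite cyclic2C cyclic2_q // (subsetP (sub_u w nuw)).
have oI : #|[set: 'I_n.-1.+1]| = n by rewrite cardsT card_ord prednK.
split.
- move=> [q i] [w j] [v k]; rewrite !in_setC !mem_center => nuq nuw nuv.
  rewrite !cyclic2_Q8xZ // !cyclic2_q // -!cycle_subG => qw wv.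
  exact: subset_trans wv qw.
- rewrite (_ : ~: _ = setX (~: <[u]>) [set: 'I_n.-1.+1]); last first.
    by apply/setP=> -[q i]; rewrite in_setX !in_setC mem_center in_setT andbT.
  rewrite cardsX oI cardsCs setCK -cardsT oQ -orderE ou; lia.
- move=> [q i]; rewrite in_setC mem_center => nuq.
  rewrite (_ : [set _ in _ | _] = setX (<[q]> :\: <[u]>) [set: 'I_n.-1.+1]).
    by rewrite cardsX oI cardsD (setIidPr (sub_u q nuq)) -!orderE oq // ou; lia.
  apply/setP=> -[w j]; rewrite in_setX in_setD in_setT andbT inE.
  by rewrite in_setC mem_center cyclic2_Q8xZ // cyclic2_q.
Qed.

(** * Transfer along the graph isomorphism and conclusion *)

(** All three conditions involve only the vertices and [cyclic2] on them, which [F] carries over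
    bijectively with inverse [F']. *)
Lemma three_classes_graph_transfer (G H : finGroupType) k :
    graph_isomorphic (non_cyclic_graph G) (non_cyclic_graph H) ->
  three_classes_graph H k -> three_classes_graph G k.
Proof.
move=> /graph_isomorphic_maps[F [F' [FK F'K cycF]]] [trH cardH classH].
have notC (K : finGroupType) (x : K) :
    reflect (~ Cyc K x) (x \in ~: center_cyclic2 K).
  by rewrite in_setC; apply: (iffP idP) => [/negP nZ /CycE|nC]; last apply/negP=> /CycE.
have FV x : x \in ~: center_cyclic2 G -> F x \in ~: center_cyclic2 H.
  by move=> /notC/FK[/notC].
have F'V y : y \in ~: center_cyclic2 H -> F' y \in ~: center_cyclic2 G.
  by move=> /notC/F'K[/notC].
have cyclic2F : {in ~: center_cyclic2 G &, forall x y,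
    cyclic2 (F x) (F y) = cyclic2 x y}.
  move=> x y /notC Vx /notC Vy; have [GH HG] := cycF x y Vx Vy.
  by apply/idP/idP=> /is_cyclic_cyclic2 ?; apply/is_cyclic_cyclic2; auto.
have F_inj : {in ~: center_cyclic2 G &, injective F}.
  by apply: (can_in_inj (g := F')) => x /notC/FK[].
have F'_Vx y : y \in ~: center_cyclic2 H -> F (F' y) = y by move=> /notC/F'K[].
split.
- move=> x y z Vx Vy Vz; rewrite -!cyclic2F //; apply: trH; exact: FV.
- rewrite -cardH -(card_in_imset F_inj); apply: eq_card => y.
  apply/imsetP/idP=> [[x Vx ->]|Vy]; first exact: FV.
  by exists (F' y); rewrite ?F'V ?F'_Vx.
move=> x Vx; rewrite -(classH (F x)) ?FV //.
rewrite -(card_in_imset (f := F)); last first.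
  by move=> y z; rewrite !inE => /andP[? _] /andP[? _]; apply: F_inj; rewrite in_setC inE.
apply: eq_card => y; apply/imsetP/idP=> [[z]|].
  by rewrite [_ \in finset _]inE => /andP[Vz xz] ->; rewrite inE FV ?cyclic2F.
rewrite inE => /andP[Vy xy]; exists (F' y); last by rewrite F'_Vx.
by rewrite inE F'V // -cyclic2F ?F'V // F'_Vx.
Qed.

Lemma isog_group_isomorphic (gT hT : finGroupType) :
  [set: gT] \isog [set: hT] -> group_isomorphic gT hT.
Proof.
case/isogP=> f inj_f im_f.
have fM : {morph f : x y / x * y} by move=> x y; rewrite morphM ?inE.
pose mf := isMultiplicative.Build gT hT f fM.
pose g : {multiplicative gT -> hT} := HB.pack (f : gT -> hT) mf.
exists g; apply: inj_card_bij; last first.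
  by rewrite -!cardsT -im_f card_injm.
by move=> x y; apply: (injmP inj_f); rewrite inE.
Qed.

Theorem proposition7p5 (n : nat) (n_gt0 : 0 < n) (n_odd : odd n)
    (G : groupType) (G_not_lc : ~ locally_cyclic G)
    (iso_graph :
      graph_isomorphic (non_cyclic_graph G) (non_cyclic_graph (Q8xZ n))) :
  group_isomorphic G (Q8xZ n).
Proof.
have GH := Q8xZ_three_classes n_gt0 n_odd.
have [F [F' [FK F'K _]]] := graph_isomorphic_maps iso_graph.
have [h nCh] : exists h, ~ Cyc (Q8xZ n) h.
  have [_ cardV _] := GH.
  have /card_gt0P[h] : 0 < #|~: center_cyclic2 ('Q_8 * 'I_n.-1.+1)%type|.
    by rewrite cardV; lia.
  by rewrite in_setC => /negP nCh; exists h => /CycE.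
(* [F' h] is a vertex of [G], and all vertices of [G] lie in the image under [F'] of a finite
   group. *)
have finG : finite_set [set: G]%classic.
  apply: (@finite_group_of_finite_setC_Cyc _ (F' h)); first by case: (F'K h nCh).
  apply: (@cardinality.sub_finite_set _ _ [set F' y | y in [set: Q8xZ n]]%classic).
    by move=> x /FK[_ <-]; exists (F x).
  by apply: finite_image; apply: (@finite_finset ('Q_8 * 'I_n.-1.+1)%type).
have [gT defG] := finite_group_finGroup finG.
move: iso_graph; rewrite -defG => iso_graph.
apply: isog_group_isomorphic.
apply: three_classes_Q8xZ => //.
exact: three_classes_graph_transfer iso_graph GH.
Qed.
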